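(* Let $n$ be a positive integer. If $n$ is even, the improper integral $\int_{0}^{\infty}\frac{\sin^{n}x}{x}\,\mathrm{d}x$ is divergent. If $n$ is odd, the improper integral converges and $$\int_{0}^{\infty}\frac{\sin^{n}x}{x}\,\mathrm{d}x=\frac{-1}{(2i)^{n}}\sum_{l=0}^{n}(-1)^{l}\binom{n}{l}\ln[i(2l-n)].$$
   Context: Here $i$ is the imaginary unit, and for a nonzero real number $a$ the complex logarithm is $\ln[ia]=\ln|a|+i\frac{\pi}{2}\,\mathrm{sign}(a)$, where $\mathrm{sign}(a)=1$ for $a>0$ and $-1$ for $a<0$. The integral is understood as the improper Riemann integral $\lim_{R\to\infty}\int_{0}^{R}$ (it is not absolutely convergent). *)

(* Defs.v *)
From Stdlib Require Import Reals.
From Coquelicot Require Import Coquelicot.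

(* ln[i a] for real a <> 0: ln|a| + i (PI/2) sign(a).
   The value at a = 0 is not meaningful. *)
Definition ln_imag (a : R) : C :=
  (RtoC (ln (Rabs a)) + Ci * RtoC (PI / 2 * sign a))%C.

(* sin^n(x) / x.  For n > 0 the value at x = 0 is 0 * / 0 = 0; changing a
   single value does not affect Riemann integrals. *)
Definition sin_pow_div (n : nat) (x : R) : R := (sin x ^ n / x)%R.

(* Main.v *)
Require Import Defs.
From Stdlib Require Import Reals Lra Lia.
From Coquelicot Require Import Coquelicot.

Local Open Scope R_scope.

(** For odd [n = 2k+1], [sin^n x] is a linear combination of the functions
    [sin ((2l-n) x)], with coefficients proportional to [(-1)^l C(n,l)]
    ([sin_odd_pow]). The integral of [sin (a x) / x] over the half-line is
    [PI/2 * sign a] ([is_RInt_gen_sin]), so the integral exists and equals the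
    corresponding combination of signs. In the complex formula, that
    combination is what the imaginary parts [PI/2 * sign (2l-n)] of the
    logarithms contribute; the real parts [ln |2l-n|] cancel in pairs under
    [l -> n-l], which reverses the sign of [(-1)^l] when [n] is odd
    ([alternating_binomial_even_fun]).

    The Dirichlet integral is obtained with an explicit rate. The function
    [J(x)], the integral of [exp (-t x) (cos x + t sin x) / (1 + t^2)] for [t]
    from [0] to [T], has derivative [sin x (exp (-T x) - 1) / x]. Hence
    [Si + J], with [Si] the integral of [sin x / x] from [0], has derivative
    [exp (-T x) sin x / x] and varies by at most [1/T] on the half-line. Since
    [J 0 = atan T] and [|J x| <= 1/x], this gives
    [|Si x - atan T| <= 1/T + 1/x]; taking [T = x] suffices
    ([RInt_sinc_atan]).

    For even [n = 2k], the Cauchy criterion fails. Bernoulli's inequality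
    applied to [(2 sin^2 x)^k = (1 - cos (2x))^k] bounds [sin^n x] below by
    [(1 - k cos (2x)) / 2^k], whose integral from [M = m PI] to [2M] is
    [M / 2^k]; dividing by [x <= 2M] leaves at least [1 / 2^(k+1)], however
    large [M] is ([RInt_sin_even_pow_lower]). *)

(** * The cardinal sine *)

Definition sinc (x : R) : R := if Req_EM_T x 0 then 1 else sin x / x.

Lemma sinc_neq_0 (x : R) : x <> 0 -> sinc x = sin x / x.
Proof. intros Hx; unfold sinc; destruct (Req_EM_T x 0); tauto. Qed.

Lemma sinc_mult (x : R) : x * sinc x = sin x.
Proof.
  unfold sinc; destruct (Req_EM_T x 0) as [->|Hx].
  - rewrite sin_0; ring.
  - field; exact Hx.
Qed.

Lemma continuous_sinc (x : R) : continuous sinc x.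
Proof.
  destruct (Req_EM_T x 0) as [->|Hx].
  - assert (H : is_lim sinc 0 1).
    { apply is_lim_ext_loc with (2 := is_lim_sinc_0).
      exists (mkposreal 1 Rlt_0_1); intros y _ Hy.
      symmetry; apply sinc_neq_0; exact Hy. }
    apply continuity_pt_filterlim, continuity_pt_filterlim'.
    unfold sinc at 2; destruct (Req_EM_T 0 0); [exact H | tauto].
  - apply continuous_ext_loc with (fun y => sin y / y).
    + exists (mkposreal _ (Rabs_pos_lt _ Hx)); intros y Hy.
      symmetry; apply sinc_neq_0; intros ->.
      revert Hy; change (~ (Rabs (0 - x) < Rabs x)).
      rewrite Rminus_0_l, Rabs_Ropp; lra.
    + apply (ex_derive_continuous (V := R_NormedModule)).
      auto_derive; exact Hx.
Qed.

Lemma sinc_bound (x : R) : Rabs (sinc x) <= 1.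
Proof.
  unfold sinc; destruct (Req_EM_T x 0) as [|Hx].
  - rewrite Rabs_R1; lra.
  - assert (H : Rabs (sin x - sin 0) <= 1 * Rabs (x - 0)).
    { apply (bounded_variation sin cos); intros t _; split.
      - auto_derive; [trivial | ring].
      - apply Rabs_le; apply COS_bound. }
    rewrite sin_0, !Rminus_0_r, Rmult_1_l in H.
    rewrite Rabs_div by exact Hx.
    apply Rle_div_l; [apply Rabs_pos_lt; exact Hx | lra].
Qed.

(** * The Dirichlet integral *)

(** This is the integral of [exp (- t s) sin s] for [s] from [x] to infinity,
    [t > 0]: integrating it over all [t > 0] would give the tail of the
    integral of [sin s / s] from [x]. *)
Definition laplace_sin (x t : R) : R :=
  exp (- (t * x)) * (cos x + t * sin x) / (1 + t ^ 2).

Lemma is_derive_laplace_sin (x t : R) :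
  is_derive (fun y => laplace_sin y t) x (- exp (- (t * x)) * sin x).
Proof.
  assert (1 + t ^ 2 <> 0) by nra.
  unfold laplace_sin; auto_derive; [trivial | field; simpl in *; nra].
Qed.

Lemma continuous_laplace_sin (x t : R) : continuous (laplace_sin x) t.
Proof.
  apply (ex_derive_continuous (V := R_NormedModule)).
  unfold laplace_sin; auto_derive; nra.
Qed.

(** By Cauchy-Schwarz, [(cos x + t sin x)^2 <= 1 + t^2 <= (1 + t^2)^2]. *)
Lemma laplace_sin_bound (x t : R) : Rabs (laplace_sin x t) <= exp (- (t * x)).
Proof.
  unfold laplace_sin.
  assert (Ht : 0 < 1 + t ^ 2) by nra.
  assert (H1 : Rabs (cos x + t * sin x) <= 1 + t ^ 2).
  { pose proof (sin2_cos2 x) as E; unfold Rsqr in E.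
    apply Rabs_le.
    (* Lagrange's identity, for the vectors (cos x, sin x) and (1, t). *)
    assert ((cos x + t * sin x) ^ 2 + (t * cos x - sin x) ^ 2 = 1 + t ^ 2).
    { transitivity ((sin x * sin x + cos x * cos x) * (1 + t ^ 2)); [ring|].
      rewrite E; ring. }
    assert ((cos x + t * sin x) ^ 2 <= (1 + t ^ 2) ^ 2) by nra.
    nra. }
  unfold Rdiv; rewrite !Rabs_mult, (Rabs_pos_eq (exp _)) by apply Rlt_le, exp_pos.
  rewrite Rabs_inv, (Rabs_pos_eq (1 + t ^ 2)) by lra.
  rewrite Rmult_assoc; rewrite <- (Rmult_1_r (exp _)) at 2.
  apply Rmult_le_compat_l; [apply Rlt_le, exp_pos|].
  apply (Rle_div_l _ _ _ Ht); lra.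
Qed.

(** Differentiation under the integral sign leaves the elementary integral of
    [- exp (- t x) sin x] in [t]. Writing [sin x = x * sinc x] gives the
    primitive [sinc x * exp (- t x)] for all [x], including [x = 0]. *)
Lemma RInt_laplace_sin_derive (T x : R) :
  is_derive (fun y => RInt (laplace_sin y) 0 T) x
    (sinc x * exp (- (T * x)) - sinc x).
Proof.
  replace (sinc x * exp (- (T * x)) - sinc x)
    with (RInt (fun t => Derive (fun u => laplace_sin u t) x) 0 T).
  - apply (is_derive_RInt_param laplace_sin).
    + apply filter_forall; intros y t _.
      eexists; apply is_derive_laplace_sin.
    + intros t _.
      apply continuity_2d_pt_ext with (fun u v => (- exp (- (v * u))) * sin u).
      { intros u v; symmetry; apply is_derive_unique, is_derive_laplace_sin. }
      apply (continuity_2d_pt_mult (fun u v => - exp (- (v * u))) (fun u _ => sin u)).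
      * apply (continuity_1d_2d_pt_comp (fun z => - exp (- z)) (fun u v => v * u)).
        { apply continuity_pt_filterlim.
          apply (ex_derive_continuous (V := R_NormedModule) (fun z => - exp (- z))).
          auto_derive; trivial. }
        apply (continuity_2d_pt_mult (fun _ v => v) (fun u _ => u));
          [apply continuity_2d_pt_id2 | apply continuity_2d_pt_id1].
      * apply (continuity_1d_2d_pt_comp sin (fun u _ => u));
          [apply continuity_sin | apply continuity_2d_pt_id1].
    + apply filter_forall; intros y.
      apply (ex_RInt_continuous (V := R_CompleteNormedModule)); intros t _.
      apply continuous_laplace_sin.
  - apply is_RInt_unique.
    apply is_RInt_ext with (fun t => - exp (- (t * x)) * sin x).
    { intros t _; symmetry; apply is_derive_unique, is_derive_laplace_sin. }
    replace (sinc x * exp (- (T * x)) - sinc x)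
      with (minus (sinc x * exp (- (T * x))) (sinc x * exp (- (0 * x)))).
    2:{ unfold minus, plus, opp; simpl.
        rewrite Rmult_0_l, Ropp_0, exp_0; ring. }
    apply (is_RInt_derive (fun t => sinc x * exp (- (t * x)))); intros t _.
    + auto_derive; [trivial|]. rewrite <- (sinc_mult x); ring.
    + apply (ex_derive_continuous (V := R_NormedModule)); auto_derive; trivial.
Qed.

Lemma ex_RInt_sinc (a b : R) : ex_RInt sinc a b.
Proof.
  apply (ex_RInt_continuous (V := R_CompleteNormedModule)); intros t _.
  apply continuous_sinc.
Qed.

Lemma RInt_sinc_derive (x : R) : is_derive (fun y => RInt sinc 0 y) x (sinc x).
Proof.
  apply (is_derive_RInt sinc _ 0); [|apply continuous_sinc].
  apply filter_forall; intros y.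
  apply (RInt_correct (V := R_CompleteNormedModule)), ex_RInt_sinc.
Qed.

(** Apply the mean value theorem to [h - g] and to [h + g], which are both
    nondecreasing. *)
Lemma derive_bound_comp (g h dg dh : R -> R) (a b : R) :
  a <= b ->
  (forall x, a <= x <= b -> is_derive g x (dg x)) ->
  (forall x, a <= x <= b -> is_derive h x (dh x)) ->
  (forall x, a <= x <= b -> Rabs (dg x) <= dh x) ->
  Rabs (g b - g a) <= h b - h a.
Proof.
  intros Hab Hg Hh Hle.
  assert (K : forall s, s = 1 \/ s = -1 -> s * (g b - g a) <= h b - h a).
  { intros s Hs.
    assert (D : forall x, a <= x <= b ->
              is_derive (fun y => h y - s * g y) x (dh x - s * dg x)).
    { intros x Hx; apply (is_derive_minus (V := R_NormedModule)).
      - apply Hh, Hx.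
      - apply is_derive_scal, Hg, Hx. }
    destruct (MVT_gen (fun y => h y - s * g y) a b (fun x => dh x - s * dg x))
      as (c & Hc & E); rewrite ?Rmin_left, ?Rmax_right in * by exact Hab.
    - intros x Hx; apply D; lra.
    - intros x Hx; apply continuity_pt_filterlim.
      apply (ex_derive_continuous (V := R_NormedModule) (fun y => h y - s * g y)).
      eexists; apply D, Hx.
    - specialize (Hle c Hc); apply Rabs_le_between in Hle.
      assert (0 <= dh c - s * dg c) by (destruct Hs; subst s; lra).
      nra. }
  apply Rabs_le; pose proof (K 1); pose proof (K (-1)); lra.
Qed.

(** One [1/x] bounds the variation of [Si + J], the other bounds [J x]; here
    the length [T] of the range of [t] in [J] is [x] itself. *)
Lemma RInt_sinc_atan (x : R) : 0 < x -> Rabs (RInt sinc 0 x - atan x) <= 2 / x.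
Proof.
  intros Hx.
  set (J := fun y => RInt (laplace_sin y) 0 x).
  assert (ExE : forall c, is_derive (fun s => - exp (- (x * s)) / x) c (exp (- (x * c)))).
  { intros c; auto_derive; [lra | field; lra]. }
  assert (H1 : Rabs ((RInt sinc 0 x + J x) - (RInt sinc 0 0 + J 0)) <= / x).
  { apply Rle_trans with (- exp (- (x * x)) / x - - exp (- (x * 0)) / x).
    - apply (derive_bound_comp (fun y => RInt sinc 0 y + J y)
               (fun s => - exp (- (x * s)) / x)
               (fun y => sinc y + (sinc y * exp (- (x * y)) - sinc y))
               (fun s => exp (- (x * s)))); [lra | | |]; intros y Hy.
      + apply (is_derive_plus (V := R_NormedModule)).
        * apply RInt_sinc_derive.
        * apply RInt_laplace_sin_derive.
      + apply ExE.
      + replace (sinc y + _) with (sinc y * exp (- (x * y))) by ring.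
        rewrite Rabs_mult, (Rabs_pos_eq (exp _)) by apply Rlt_le, exp_pos.
        pose proof (sinc_bound y); pose proof (exp_pos (- (x * y))); nra.
    - rewrite Rmult_0_r, Ropp_0, exp_0.
      assert (0 < exp (- (x * x)) / x) by (apply Rdiv_lt_0_compat; [apply exp_pos | lra]).
      unfold Rdiv in *; lra. }
  assert (HJ0 : J 0 = atan x).
  { unfold J; apply is_RInt_unique.
    apply is_RInt_ext with (fun t => / (1 + t ^ 2)).
    { intros t _; change (@eq R (/ (1 + t ^ 2)) (laplace_sin 0 t)); unfold laplace_sin.
      rewrite Rmult_0_r, Ropp_0, exp_0, cos_0, sin_0; field; nra. }
    replace (atan x) with (minus (atan x) (atan 0))
      by (rewrite atan_0; unfold minus, plus, opp; simpl; ring).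
    apply (is_RInt_derive atan); intros t _.
    - auto_derive; [trivial | unfold Rsqr; field; nra].
    - apply (ex_derive_continuous (V := R_NormedModule)); auto_derive; nra. }
  assert (HJx : Rabs (J x) <= / x).
  { unfold J.
    eapply Rle_trans; [apply abs_RInt_le; [lra|]|].
    { apply (ex_RInt_continuous (V := R_CompleteNormedModule)); intros t _.
      apply continuous_laplace_sin. }
    assert (HE : is_RInt (fun t => exp (- (x * t))) 0 x
              (minus (- exp (- (x * x)) / x) (- exp (- (x * 0)) / x))).
    { apply (is_RInt_derive (fun t => - exp (- (x * t)) / x)); intros t _.
      - apply ExE.
      - apply (ex_derive_continuous (V := R_NormedModule)); auto_derive; trivial. }
    apply Rle_trans with (RInt (fun t => exp (- (x * t))) 0 x).
    - apply RInt_le; [lra | | eexists; exact HE |].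
      + apply (ex_RInt_continuous (V := R_CompleteNormedModule)); intros t _.
        apply continuous_comp;
          [apply continuous_laplace_sin | apply continuous_Rabs].
      + intros t _; rewrite (Rmult_comm x t); apply laplace_sin_bound.
    - rewrite (is_RInt_unique _ _ _ _ HE).
      unfold minus, plus, opp; simpl.
      rewrite Rmult_0_r, Ropp_0, exp_0.
      assert (0 < exp (- (x * x)) / x) by (apply Rdiv_lt_0_compat; [apply exp_pos | lra]).
      unfold Rdiv in *; lra. }
  rewrite RInt_point, HJ0 in H1; change (@zero _) with 0 in H1.
  replace (2 / x) with (/ x + / x) by (field; lra).
  apply Rabs_le_between in H1; apply Rabs_le_between in HJx.
  apply Rabs_le; lra.
Qed.

Lemma atan_le_id (u : R) : 0 <= u -> atan u <= u.
Proof.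
  intros Hu.
  assert (H : Rabs (atan u - atan 0) <= u - 0).
  { apply (derive_bound_comp atan (fun x => x) (fun x => / (1 + x ^ 2)) (fun _ => 1));
      [exact Hu | | |]; intros x _.
    - auto_derive; [trivial | unfold Rsqr; field; nra].
    - auto_derive; trivial.
    - assert (1 <= 1 + x ^ 2) by nra.
      rewrite Rabs_pos_eq by (apply Rlt_le, Rinv_0_lt_compat; lra).
      rewrite <- Rinv_1; apply Rinv_le_contravar; lra. }
  rewrite atan_0 in H; apply Rabs_le_between in H; lra.
Qed.

Lemma RInt_sinc_PI2 (x : R) : 0 < x -> Rabs (RInt sinc 0 x - PI / 2) <= 3 / x.
Proof.
  intros Hx.
  pose proof (RInt_sinc_atan x Hx) as H.
  pose proof (atan_inv x Hx) as E.
  pose proof (atan_bound x) as B.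
  assert (Hi : 0 < / x) by (apply Rinv_0_lt_compat; exact Hx).
  pose proof (atan_le_id (/ x) (Rlt_le _ _ Hi)).
  apply Rabs_le_between in H; apply Rabs_le; unfold Rdiv in *; lra.
Qed.

(** The substitution [x -> a x] turns the integral up to [y] into
    [RInt sinc 0 (a * y)]. *)
Lemma is_RInt_gen_sin_pos (a : R) : 0 < a ->
  is_RInt_gen (fun x => sin (a * x) / x) (at_point 0) (Rbar_locally p_infty) (PI / 2).
Proof.
  intros Ha P [eps HP].
  exists (fun x => x = 0) (fun y => 3 / (a * eps) < y); [reflexivity | eexists; intros y Hy; exact Hy|].
  intros x y -> Hy; simpl.
  assert (H3 : 0 < 3 / (a * eps)).
  { apply Rdiv_lt_0_compat; [lra | apply Rmult_lt_0_compat; [lra | apply cond_pos]]. }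
  assert (Hay : 0 < a * y) by (apply Rmult_lt_0_compat; lra).
  exists (RInt sinc 0 (a * y)); split.
  - apply is_RInt_ext with (fun t => scal a (sinc (a * t + 0))).
    { intros t Ht; rewrite Rmin_left, Rmax_right in Ht by lra.
      unfold scal; simpl; unfold mult; simpl.
      rewrite Rplus_0_r, sinc_neq_0 by nra. field; lra. }
    apply (is_RInt_comp_lin (V := R_NormedModule)).
    replace (a * 0 + 0) with 0 by ring; rewrite Rplus_0_r.
    apply (RInt_correct (V := R_CompleteNormedModule)), ex_RInt_sinc.
  - apply HP; change (Rabs (RInt sinc 0 (a * y) - PI / 2) < eps).
    eapply Rle_lt_trans; [apply RInt_sinc_PI2, Hay|].
    apply Rlt_div_l in Hy; [|apply Rmult_lt_0_compat; [lra | apply cond_pos]].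
    apply Rlt_div_l; lra.
Qed.

Lemma is_RInt_gen_sin (a : R) :
  is_RInt_gen (fun x => sin (a * x) / x) (at_point 0) (Rbar_locally p_infty)
    (PI / 2 * sign a).
Proof.
  destruct (total_order_T a 0) as [[Ha | ->] | Ha].
  - rewrite sign_eq_m1 by exact Ha.
    replace (PI / 2 * -1) with (opp (PI / 2)) by (unfold opp; simpl; ring).
    apply is_RInt_gen_ext with (fun x => opp (sin (- a * x) / x)).
    { apply filter_forall; intros ab x _; unfold opp; simpl.
      rewrite Ropp_mult_distr_l_reverse, sin_neg; unfold Rdiv; ring. }
    apply (is_RInt_gen_opp (V := R_NormedModule)), is_RInt_gen_sin_pos; lra.
  - rewrite sign_0.
    replace (PI / 2 * 0) with (scal 0 (PI / 2)) by (unfold scal; simpl; unfold mult; simpl; ring).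
    apply is_RInt_gen_ext with (fun x => scal 0 (sin (1 * x) / x)).
    { apply filter_forall; intros ab x _; unfold scal; simpl; unfold mult; simpl.
      rewrite (Rmult_0_l x), sin_0; unfold Rdiv; ring. }
    apply (is_RInt_gen_scal (V := R_NormedModule)), is_RInt_gen_sin_pos; lra.
  - rewrite sign_eq_1, Rmult_1_r by exact Ha.
    apply is_RInt_gen_sin_pos, Ha.
Qed.

(** * Even powers *)

Lemma Bernoulli_inequality (k : nat) (y : R) : -1 <= y -> 1 + INR k * y <= (1 + y) ^ k.
Proof.
  intros Hy; induction k as [|k IH]; [simpl; lra|].
  rewrite S_INR; simpl.
  pose proof (pos_INR k).
  assert (0 <= INR k * (y * y)) by (apply Rmult_le_pos; nra).
  nra.
Qed.

(** Bernoulli's inequality at [- cos (2 x)], since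
    [sin^2 x = (1 - cos (2 x)) / 2]. *)
Lemma sin_even_pow_lower (k : nat) (x : R) :
  (/ 2) ^ k * (1 - INR k * cos (2 * x)) <= sin x ^ (2 * k).
Proof.
  replace (sin x ^ (2 * k)) with ((/ 2) ^ k * (1 + - cos (2 * x)) ^ k).
  - apply Rmult_le_compat_l; [apply pow_le; lra|].
    replace (1 - INR k * cos (2 * x)) with (1 + INR k * - cos (2 * x)) by ring.
    apply Bernoulli_inequality; pose proof (COS_bound (2 * x)); lra.
  - rewrite <- Rpow_mult_distr, pow_mult; f_equal.
    rewrite cos_2a_sin; field.
Qed.

(** The endpoints are multiples of [PI] so that the oscillating part
    [cos (2 x)] of the minorant integrates to exactly [0]. *)
Lemma RInt_sin_even_pow_lower (k m : nat) (v : R) : (0 < m)%nat ->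
  is_RInt (sin_pow_div (2 * k)) (INR m * PI) (2 * (INR m * PI)) v ->
  (/ 2) ^ k / 2 <= v.
Proof.
  intros Hm Hv.
  pose proof PI_RGT_0 as HPI.
  assert (HM : 0 < INR m * PI) by (apply Rmult_lt_0_compat; [apply lt_0_INR; lia | lra]).
  set (M := INR m * PI) in *.
  set (F := fun x => (/ 2) ^ k / (2 * M) * (x - INR k * (sin (2 * x) / 2))).
  set (dF := fun x => (/ 2) ^ k / (2 * M) * (1 - INR k * cos (2 * x))).
  assert (HF : is_RInt dF M (2 * M) (minus (F (2 * M)) (F M))).
  { apply (is_RInt_derive F); intros x _; unfold F, dF.
    - auto_derive; [trivial | field; lra].
    - apply (ex_derive_continuous (V := R_NormedModule)); auto_derive; trivial. }
  assert (Hsin : forall j, sin (2 * INR j * PI) = 0).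
  { intros j; replace (2 * INR j * PI) with (0 + 2 * INR j * PI) by ring.
    rewrite sin_period; apply sin_0. }
  replace ((/ 2) ^ k / 2) with (minus (F (2 * M)) (F M)).
  2:{ unfold F, minus, plus, opp; simpl.
      replace (2 * (2 * M)) with (2 * INR (2 * m) * PI)
        by (rewrite mult_INR; unfold M; simpl; ring).
      replace (sin (2 * M)) with 0
        by (rewrite <- (Hsin m); f_equal; unfold M; ring).
      rewrite Hsin; field; lra. }
  apply (is_RInt_le dF (sin_pow_div (2 * k)) M (2 * M)); [lra | exact HF | exact Hv |].
  intros x Hx; unfold dF, sin_pow_div.
  assert (Hpos : 0 <= sin x ^ (2 * k)).
  { rewrite pow_mult; apply pow_le, pow2_ge_0. }
  apply Rle_trans with (sin x ^ (2 * k) / (2 * M)).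
  - replace ((/ 2) ^ k / (2 * M) * (1 - INR k * cos (2 * x)))
      with (/ 2 ^ k * (1 - INR k * cos (2 * x)) / (2 * M)) by (rewrite pow_inv; unfold Rdiv; ring).
    rewrite <- pow_inv.
    apply Rmult_le_compat_r; [apply Rlt_le, Rinv_0_lt_compat; lra | apply sin_even_pow_lower].
  - apply Rmult_le_compat_l; [exact Hpos | apply Rinv_le_contravar; lra].
Qed.

(** Two partial integrals within [2^(-k) / 8] of a limit cannot differ by
    [2^(-k) / 2]. *)
Lemma sin_even_pow_diverges (k : nat) :
  ~ ex_RInt_gen (sin_pow_div (2 * k)) (at_point 0) (Rbar_locally p_infty).
Proof.
  intros [L HL].
  assert (Hc : 0 < (/ 2) ^ k / 8) by (apply Rdiv_lt_0_compat; [apply pow_lt; lra | lra]).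
  destruct (HL _ (locally_ball L (mkposreal _ Hc))) as [Q S HQ [N HS] H].
  pose proof PI_RGT_0 as HPI.
  destruct (nfloor_ex (Rabs N / PI)) as [m0 [_ Hm]].
  { apply Rle_div_r; [lra | rewrite Rmult_0_l; apply Rabs_pos]. }
  apply Rlt_div_l in Hm; [|lra].
  rewrite <- S_INR in Hm.
  pose proof (Rle_abs N); pose proof (Rabs_pos N).
  destruct (H 0 (INR (Datatypes.S m0) * PI)) as (v1 & I1 & B1); [exact HQ | apply HS; lra |].
  destruct (H 0 (2 * (INR (Datatypes.S m0) * PI))) as (v2 & I2 & B2); [exact HQ | apply HS; lra |].
  cbv [fst snd] in I1, I2.
  assert (I3 := is_RInt_Chasles _ _ _ _ _ _ (is_RInt_swap _ _ _ _ I1) I2).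
  apply RInt_sin_even_pow_lower in I3; [|lia].
  change (Rabs (v1 - L) < (/ 2) ^ k / 8) in B1.
  change (Rabs (v2 - L) < (/ 2) ^ k / 8) in B2.
  unfold plus, opp in I3; simpl in I3.
  apply Rabs_lt_between in B1; apply Rabs_lt_between in B2; lra.
Qed.

(** * Expansion of odd powers of the sine *)

Lemma C_n_0 (n : nat) : Binomial.C n 0 = 1.
Proof. unfold Binomial.C; rewrite Nat.sub_0_r; simpl; field; apply INR_fact_neq_0. Qed.

Lemma C_n_n (n : nat) : Binomial.C n n = 1.
Proof. rewrite pascal_step1, Nat.sub_diag by lia; apply C_n_0. Qed.

Lemma pow_opp1_sqr (k : nat) : (-1) ^ k * (-1) ^ k = 1.
Proof. rewrite <- Rpow_mult_distr; replace (-1 * -1) with 1 by ring; apply pow1. Qed.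

(** Pascal's rule in the form: the finite difference of order [n+1] is the one
    of order [n] applied to the first difference. *)
Lemma alternating_binomial_step (u : nat -> R) (n : nat) :
  sum_f_R0 (fun l => (-1) ^ l * Binomial.C (S n) l * u l) (S n) =
  sum_f_R0 (fun l => (-1) ^ l * Binomial.C n l * (u l - u (S l))) n.
Proof.
  assert (K : forall m, (m <= n)%nat ->
    sum_f_R0 (fun l => (-1) ^ l * Binomial.C (S n) l * u l) m =
    sum_f_R0 (fun l => (-1) ^ l * Binomial.C n l * (u l - u (S l))) m
      + (-1) ^ m * Binomial.C n m * u (S m)).
  { induction m as [|m IH]; intros Hm.
    - simpl; rewrite !C_n_0; ring.
    - rewrite !tech5, IH, <- pascal by lia; simpl; ring. }
  rewrite tech5, K, !C_n_n by lia; simpl; ring.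
Qed.

(** The binomial expansion of [(exp (- i x) - exp (i x))^n], stated over the
    reals. The phase [phi] is what makes the induction go through: a first
    difference [sin (th - x) - sin (th + x) = 2 sin x * sin (th - PI/2)] brings
    out one factor [2 sin x] and shifts the phase by [- PI/2]. *)
Lemma sin_pow_expand (n : nat) (x phi : R) :
  sum_f_R0 (fun l => (-1) ^ l * Binomial.C n l * sin ((2 * INR l - INR n) * x + phi)) n =
  (2 * sin x) ^ n * sin (phi - INR n * (PI / 2)).
Proof.
  revert phi; induction n as [|n IH]; intros phi.
  - simpl; rewrite C_n_0.
    replace ((2 * 0 - 0) * x + phi) with phi by ring.
    replace (phi - 0 * (PI / 2)) with phi by ring; ring.
  - rewrite alternating_binomial_step.
    rewrite S_INR.
    replace (phi - (INR n + 1) * (PI / 2)) with ((phi - PI / 2) - INR n * (PI / 2)) by ring.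
    rewrite <- tech_pow_Rmult, Rmult_assoc, <- IH, scal_sum.
    apply sum_eq; intros l _.
    set (th := (2 * INR l - INR n) * x + phi).
    replace ((2 * INR l - (INR n + 1)) * x + phi) with (th - x) by (unfold th; ring).
    replace ((2 * INR (S l) - (INR n + 1)) * x + phi) with (th + x)
      by (unfold th; rewrite S_INR; ring).
    replace ((2 * INR l - INR n) * x + (phi - PI / 2)) with (- (PI / 2 - th))
      by (unfold th; field).
    rewrite sin_neg, sin_shift, sin_minus, sin_plus; ring.
Qed.

Definition odd_coeff (k l : nat) : R :=
  - (-1) ^ k / 2 ^ (2 * k + 1) * ((-1) ^ l * Binomial.C (2 * k + 1) l).

(** The case of phase [0], where [sin (- (2k+1) PI/2) = - (-1)^k]. *)
Lemma sin_odd_pow (k : nat) (x : R) :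
  sin x ^ (2 * k + 1) =
  sum_f_R0 (fun l => odd_coeff k l * sin ((2 * INR l - INR (2 * k + 1)) * x)) (2 * k + 1).
Proof.
  assert (Hs : forall j, sin (0 - INR (2 * j + 1) * (PI / 2)) = - (-1) ^ j).
  { induction j as [|j IH].
    - simpl; replace (0 - 1 * (PI / 2)) with (- (PI / 2)) by ring.
      rewrite sin_neg, sin_PI2; ring.
    - replace (0 - INR (2 * S j + 1) * (PI / 2)) with (- ((INR (2 * j + 1) * (PI / 2)) + PI))
        by (rewrite !plus_INR, !mult_INR, (S_INR j); simpl INR; field).
      rewrite sin_neg, neg_sin, <- sin_neg, <- (Rminus_0_l (_ * _)).
      replace (sin _) with (- (-1) ^ j) by (rewrite <- IH; reflexivity).
      simpl; ring. }
  pose proof (sin_pow_expand (2 * k + 1) x 0) as E.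
  rewrite Hs, Rpow_mult_distr in E.
  assert (H2 : 2 ^ (2 * k + 1) <> 0) by (apply pow_nonzero; lra).
  transitivity (- (-1) ^ k / 2 ^ (2 * k + 1) *
                (2 ^ (2 * k + 1) * sin x ^ (2 * k + 1) * - (-1) ^ k)).
  - transitivity (sin x ^ (2 * k + 1) * ((-1) ^ k * (-1) ^ k)); [rewrite pow_opp1_sqr; ring | field; exact H2].
  - rewrite <- E, scal_sum; apply sum_eq; intros l _.
    unfold odd_coeff; rewrite Rplus_0_r; ring.
Qed.

(** * Odd powers *)

Lemma is_RInt_gen_sum (Fa Fb : (R -> Prop) -> Prop) {FFa : Filter Fa} {FFb : Filter Fb}
  (f : nat -> R -> R) (v : nat -> R) (n : nat) :
  (forall l, is_RInt_gen (f l) Fa Fb (v l)) ->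
  is_RInt_gen (fun x => sum_f_R0 (fun l => f l x) n) Fa Fb (sum_f_R0 v n).
Proof.
  intros H; induction n as [|n IH]; [apply H|].
  exact (is_RInt_gen_plus (V := R_NormedModule) _ _ _ _ IH (H (S n))).
Qed.

Lemma is_RInt_gen_sin_odd_pow (k : nat) :
  is_RInt_gen (sin_pow_div (2 * k + 1)) (at_point 0) (Rbar_locally p_infty)
    (- (-1) ^ k / 2 ^ (2 * k + 1) *
     sum_f_R0 (fun l => (-1) ^ l * Binomial.C (2 * k + 1) l *
                        (PI / 2 * sign (2 * INR l - INR (2 * k + 1)))) (2 * k + 1)).
Proof.
  rewrite scal_sum.
  apply is_RInt_gen_ext with (fun x => sum_f_R0 (fun l =>
    scal (odd_coeff k l) (sin ((2 * INR l - INR (2 * k + 1)) * x) / x)) (2 * k + 1)).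
  { apply filter_forall; intros ab x _; unfold sin_pow_div.
    rewrite sin_odd_pow; unfold Rdiv at 2; rewrite Rmult_comm, scal_sum.
    apply sum_eq; intros l _; unfold scal; simpl; unfold mult; simpl.
    unfold Rdiv; ring. }
  erewrite sum_eq.
  - apply (is_RInt_gen_sum (at_point 0) (Rbar_locally p_infty) _
      (fun l => scal (odd_coeff k l) (PI / 2 * sign (2 * INR l - INR (2 * k + 1))))).
    intros l; apply (is_RInt_gen_scal (V := R_NormedModule)), is_RInt_gen_sin.
  - intros l _; unfold odd_coeff, scal; simpl; unfold mult; simpl; ring.
Qed.

(** The terms of indices [l] and [n-l], with [n = 2k+1], are opposite: the
    arguments of [g] are opposite, the binomial coefficients equal, and
    [(-1)^(n-l) = - (-1)^l]. *)
Lemma alternating_binomial_even_fun (g : R -> R) (k : nat) :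
  (forall a, g (- a) = g a) ->
  sum_f_R0 (fun l => (-1) ^ l * Binomial.C (2 * k + 1) l *
                     g (2 * INR l - INR (2 * k + 1))) (2 * k + 1) = 0.
Proof.
  intros Hg; set (n := (2 * k + 1)%nat).
  set (u := fun l => (-1) ^ l * Binomial.C n l * g (2 * INR l - INR n)).
  assert (Hpow : forall l, (l <= n)%nat -> (-1) ^ (n - l) = - (-1) ^ l).
  { intros l Hl.
    assert (H : (-1) ^ (n - l) * (-1) ^ l = -1).
    { rewrite <- pow_add.
      replace (n - l + l)%nat with (S (2 * k)) by (unfold n in *; lia).
      apply pow_1_odd. }
    transitivity ((-1) ^ (n - l) * ((-1) ^ l * (-1) ^ l)); [rewrite pow_opp1_sqr; ring|].
    rewrite <- Rmult_assoc, H; ring. }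
  assert (E : sum_f_R0 u n = - sum_f_R0 u n).
  { rewrite <- (sum_f_R0_skip u) at 1.
    replace (- sum_f_R0 u n) with (-1 * sum_f_R0 u n) by ring.
    rewrite scal_sum; apply sum_eq; intros l Hl; unfold u.
    rewrite Hpow, <- pascal_step1, minus_INR by exact Hl.
    replace (2 * (INR n - INR l) - INR n) with (- (2 * INR l - INR n)) by ring.
    rewrite Hg; ring. }
  fold u; lra.
Qed.

Lemma sum_n_re_im (a b : nat -> R) (n : nat) :
  sum_n (fun l => RtoC (a l) + Ci * RtoC (b l))%C n =
  (RtoC (sum_f_R0 a n) + Ci * RtoC (sum_f_R0 b n))%C.
Proof.
  induction n as [|n IH]; [apply sum_O|].
  rewrite sum_Sn, IH; simpl sum_f_R0; rewrite !RtoC_plus.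
  unfold plus; simpl; ring.
Qed.

Lemma Ci_odd_pow (k : nat) : (Ci ^ (2 * k + 1))%C = (RtoC ((-1) ^ k) * Ci)%C.
Proof.
  rewrite Cpow_add_r, Cpow_mult_r, Cpow_1_r, RtoC_pow; do 2 f_equal.
  apply injective_projections; simpl; ring.
Qed.

Theorem mainTheorem2 (n : nat) (hn : (0 < n)%nat) :
  (Nat.Even n ->
     ~ ex_RInt_gen (sin_pow_div n) (at_point 0%R) (Rbar_locally p_infty)) /\
  (Nat.Odd n ->
     ex_RInt_gen (sin_pow_div n) (at_point 0%R) (Rbar_locally p_infty) /\
     RtoC (RInt_gen (sin_pow_div n) (at_point 0%R) (Rbar_locally p_infty)) =
       (RtoC (-1) / (RtoC 2 * Ci) ^ n *
        sum_n (fun l : nat =>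
                 RtoC (-1) ^ l * RtoC (Binomial.C n l) *
                 ln_imag (2 * INR l - INR n)%R) n)%C).
Proof.
  split.
  - intros [k ->]; apply sin_even_pow_diverges.
  - intros [k ->].
    assert (H := is_RInt_gen_sin_odd_pow k).
    split; [eexists; exact H|].
    rewrite (is_RInt_gen_unique _ _ H).
    set (B := sum_f_R0 _ _).
    assert (E : sum_n (fun l : nat =>
                 RtoC (-1) ^ l * RtoC (Binomial.C (2 * k + 1) l) *
                 ln_imag (2 * INR l - INR (2 * k + 1))%R)%C (2 * k + 1)
              = (Ci * RtoC B)%C).
    (* The real parts of the logarithms sum to 0. *)
    { transitivity (RtoC 0 + Ci * RtoC B)%C; [|apply Cplus_0_l].
      rewrite <- (alternating_binomial_even_fun (fun a => ln (Rabs a)) k)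
        by (intros a; rewrite Rabs_Ropp; reflexivity).
      unfold B; rewrite <- sum_n_re_im; apply sum_n_ext; intros l.
      unfold ln_imag; rewrite !RtoC_mult, !RtoC_pow; match goal with |- ?a = ?b => change (@eq C a b) end; ring. }
    rewrite E, Cpow_mult_l, Ci_odd_pow, <- RtoC_pow.
    assert (H2 : 2 ^ (2 * k + 1) <> 0) by (apply pow_nonzero; lra).
    assert (H1 : (-1) ^ k <> 0) by (apply pow_nonzero; lra).
    assert (Hinv : / (-1) ^ k = (-1) ^ k).
    { rewrite <- pow_inv; f_equal; field. }
    replace (- (-1) ^ k / 2 ^ (2 * k + 1) * B)
      with (-1 / (2 ^ (2 * k + 1) * (-1) ^ k) * B)
      by (unfold Rdiv; rewrite Rinv_mult, Hinv; ring).
    rewrite RtoC_mult, RtoC_div, RtoC_mult by (apply Rmult_integral_contrapositive_currified; assumption).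
    field; repeat split.
    + intros Hi; apply (f_equal snd) in Hi; simpl in Hi; lra.
    + intros Hi; apply RtoC_inj in Hi; exact (H1 Hi).
    + intros Hi; apply RtoC_inj in Hi; exact (H2 Hi).
Qed.
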